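(* Let $H$ be a hypergraph without multiple edges. Let $n^-, n^0, n^+$ denote the number of eigenvalues (counted with multiplicity) of the unified matrix $\mathbf{U}(H)$ which are less than, equal to, or greater than $0$, respectively, and let $\lambda_1(H)$ be its largest eigenvalue. Then the complete-clique number of $H$ satisfies $$\omega(H)\leq \min\{n^-+n^0+1,\ n^0+n^+,\ \lambda_1(H)\}.$$
   Context: A hypergraph $H$ consists of a finite non-empty vertex set $V(H)$ and a multiset $E(H)$ of non-empty subsets of $V(H)$, called edges; edges of cardinality one (loops) are allowed. A 2-partition of a set $e$ is an unordered pair $\{S,S'\}$ of non-empty disjoint sets with $S\cup S'=e$; $S$ and $S'$ are called parts of $e$. $I(H)$ is the set of all parts of all edges of $H$ together with all singleton subsets of $V(H)$. For $H$ without multiple edges, the unified matrix $\mathbf{U}(H)$ is the matrix indexed by $I(H)$ whose $(S,S')$ entry is: $1$ if $S=S'$ is a singleton which is an edge of $H$; $1$ if $\{S,S'\}$ is a 2-partition of an edge of $H$; and $0$ otherwise. A hypergraph is complete if its edge set is the set of all non-empty subsets of its vertex set. A subhypergraph $H'$ of $H$ is a hypergraph with $V(H')\subseteq V(H)$ and $E(H')\subseteq E(H)$. A complete-clique in $H$ is a complete subhypergraph of $H$. The complete-clique number $\omega(H)$ is the number of vertices in a largest complete-clique of $H$ if $H$ contains a complete-clique, and $0$ otherwise. *)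

(* Defs.v *)
From HB Require Import structures.
From mathcomp Require Import all_boot all_order all_algebra.
From mathcomp Require Import finmap multiset polyrcf.
From mathcomp Require Import boolp.

Set Implicit Arguments.
Unset Strict Implicit.
Unset Printing Implicit Defensive.

Import GRing.Theory Num.Theory.

Local Open Scope nat_scope.

(* The ambient type T only serves as a supply of vertices, so that
   subhypergraphs may have fewer vertices. *)
Record hypergraph (T : finType) := Hypergraph {
  vertices : {set T};
  edges : {mset {set T}}%mset;
  vertices_neq0 : vertices != set0;
  edges_sub : forall e, e \in edges -> (e != set0) && (e \subset vertices)
}.

Section Hypergraphs.
Variable T : finType.
Implicit Types (H K : hypergraph T) (e S : {set T}).

Definition no_multiple_edges H : Prop := forall e, edges H e <= 1.

Definition two_partition e S S' : bool :=
  [&& S != set0, S' != set0, [disjoint S & S'] & S :|: S' == e].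

Definition is_part e S : bool := [exists S' : {set T}, two_partition e S S'].

Definition parts_index H : {set {set T}} :=
  [set S : {set T} | [exists e : {set T}, (e \in edges H) && is_part e S]]
    :|: [set [set v] | v in vertices H].

Definition complete H : Prop :=
  forall e, edges H e = ((e != set0) && (e \subset vertices H)) :> nat.

Definition subhypergraph K H : Prop :=
  vertices K \subset vertices H /\ (edges K `<=` edges H)%mset.

Definition complete_clique K H : Prop := subhypergraph K H /\ complete K.

(* W ranges over the vertex sets of complete-cliques; the empty maximum is 0. *)
Definition complete_clique_number H : nat :=
  \max_(W : {set T} | `[< exists K, complete_clique K H /\ vertices K = W >])
    #|W|.

End Hypergraphs.

Local Open Scope ring_scope.

Definition unified_entry (R : nzRingType) (T : finType) (H : hypergraph T)
    (S S' : {set T}) : R :=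
  if [&& S == S', #|S| == 1%N & S \in edges H] then 1
  else if [exists e : {set T}, (e \in edges H) && two_partition e S S'] then 1
  else 0.

Definition unified_matrix (R : nzRingType) (T : finType) (H : hypergraph T) :
    'M[R]_#|parts_index H| :=
  \matrix_(i, j) unified_entry R H (enum_val i) (enum_val j).

Section Spectrum.
Variables (R : rcfType) (n : nat).
Implicit Type A : 'M[R]_n.

(* Each root of the characteristic polynomial lying in R, repeated according
   to its multiplicity; for symmetric A these are all the eigenvalues. *)
Definition eigenvalues A : seq R :=
  flatten [seq nseq (mup a (char_poly A)) a | a <- rootsR (char_poly A)].

Definition n_neg A : nat := count (fun a => a < 0) (eigenvalues A).
Definition n_zero A : nat := count (fun a => a == 0) (eigenvalues A).
Definition n_pos A : nat := count (fun a => 0 < a) (eigenvalues A).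

(* The default [head 0] belongs to the list whenever the list is non-empty. *)
Definition largest_eigenvalue A : R :=
  \big[Num.max/head 0 (eigenvalues A)]_(a <- eigenvalues A) a.

End Spectrum.

(* Main.v *)
Require Import Defs.
From mathcomp Require Import all_boot all_order all_algebra.
From mathcomp Require Import multiset boolp polyrcf complex zify.

(** Why the bound holds. If [W] carries a complete-clique then every singleton
    in [W] is a loop and every pair in [W] is an edge, so the rows and columns
    of the unified matrix [U] indexed by the singletons of [W] form a block of
    ones [J] of order [k = #|W|] ([clique_ones_submatrix]). The quadratic form
    of [J] is the square of the sum of the coordinates. Hence the form of [U]
    is nonnegative on the [k]-dimensional space of vectors supported on these
    indices, vanishes on the hyperplane of vectors of coordinate sum zero, and
    has Rayleigh quotient [k] on the all-ones vector.

    Each of the three facts bounds a number of eigenvalues from below by the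
    Courant-Fischer principle: a subspace on which the form is at least (at
    most) [c] times the square norm has dimension at most the number of
    eigenvalues that are at least (at most) [c]
    ([rank_le_count_eigenvalues_ge] and its dual). The constants [0], [0] and
    [k] give the three terms of the minimum. When there is no complete-clique
    it remains to see that the largest eigenvalue is nonnegative, and it is at
    least the diagonal entry at any singleton.

    The spectral theorem is applied over [R[i]], to the image of the real
    symmetric matrix, with subspaces of complex vectors. Its diagonal is real,
    and since the characteristic polynomial splits with these diagonal entries
    as roots, they are the eigenvalues of the real matrix with the right
    multiplicities ([eigenvalues_spectral]). *)

Set Implicit Arguments.
Unset Strict Implicit.
Unset Printing Implicit Defensive.

Import Order.TTheory GRing.Theory Num.Theory.
Local Open Scope ring_scope.

(** * Eigenvalues as roots of the characteristic polynomial *)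

Lemma mup_prod_XsubC (F : fieldType) (a : F) (s : seq F) :
  mup a (\prod_(b <- s) ('X - b%:P)) = count_mem a s.
Proof.
elim: s => [|b s IHs]; first by rewrite big_nil mupNroot // root1.
have nz : \prod_(b <- s) ('X - b%:P) != 0.
  by apply/monic_neq0/monic_prod_XsubC.
rewrite big_cons mupM ?polyXsubC_eq0 // IHs /=.
by rewrite -['X - b%:P]expr1 mup_XsubCX; case: eqVneq.
Qed.

Lemma count_mem_eigenvalues (R : rcfType) n (A : 'M[R]_n) a :
  count_mem a (eigenvalues A) = mup a (char_poly A).
Proof.
have nz : char_poly A != 0 by apply/monic_neq0/char_poly_monic.
rewrite /eigenvalues count_flatten -map_comp sumnE big_map.
under eq_bigr => b _ do rewrite /= count_nseq.
have [ra|ra] := boolP (root (char_poly A) a).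
  have a_in : a \in rootsR (char_poly A).
    by apply: (root_roots_on (roots_on_rootsR nz)); rewrite ?in_itv.
  rewrite (bigD1_seq a) ?uniq_roots //= eqxx mul1n big1 ?addn0 // => b.
  by move=> /negPf; rewrite eq_sym => ->.
rewrite mupNroot // big1_seq // => b /andP[_ b_in].
have [ba|nba] := eqVneq b a; last by rewrite /= (negPf nba).
by rewrite ba mupNroot // muln0.
Qed.

Lemma perm_eigenvalues (R : rcfType) n (A : 'M[R]_n) (s : seq R) :
  char_poly A = \prod_(a <- s) ('X - a%:P) -> perm_eq (eigenvalues A) s.
Proof.
move=> pA; apply/allP => a _ /=.
by rewrite count_mem_eigenvalues pA mup_prod_XsubC.
Qed.

Lemma char_poly_conj (F : fieldType) n (P A : 'M[F]_n) :
  P \in unitmx -> char_poly (invmx P *m A *m P) = char_poly A.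
Proof.
move=> Pu; rewrite /char_poly; set P' := map_mx polyC P.
have -> : char_poly_mx (invmx P *m A *m P) = invmx P' *m char_poly_mx A *m P'.
  rewrite /char_poly_mx mulmxBr mulmxBl !map_mxM /= map_invmx.
  by rewrite scalar_mxC mulmxKV ?map_unitmx.
by rewrite !det_mulmx det_inv mulrAC mulVr ?mul1r // -unitmxE map_unitmx.
Qed.

(** * Counting eigenvalues with subspaces *)

Section Hermitian.
Local Open Scope sesquilinear_scope.
Context {C : numClosedFieldType}.

(** If the dimension of [V] exceeded the number of nonnegative [d i], then [V]
    would contain a nonzero vector vanishing at all of these coordinates, and
    the form would be negative there. *)
Lemma rank_diag_form_ge0 m n (V : 'M[C]_(m, n)) (d : 'I_n -> C) :
    (forall i, d i \is Num.real) ->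
    (forall x : 'rV_n, (x <= V)%MS -> 0 <= \sum_i d i * `|x 0 i| ^+ 2) ->
  (\rank V <= #|[pred i | (0 <= d i)%R]|)%N.
Proof.
move=> d_real V_ge0; set N := [pred i | 0 <= d i].
pose proj := \matrix_(i < n, j < #|N|) (i == enum_val j)%:R : 'M[C]_(n, #|N|).
rewrite leqNgt; apply/negP => lt_N.
have : (V :&: kermx proj)%MS != 0.
  rewrite -mxrank_eq0 -lt0n -(ltn_add2l (\rank (V *m proj))) addn0.
  by rewrite mxrank_mul_ker (leq_ltn_trans (rank_leq_col _)).
case/rowV0Pn => x; rewrite sub_capmx => /andP[xV /sub_kermxP xproj] xN0.
(* [proj] keeps exactly the coordinates in [N], so [x] vanishes there. *)
have x0 i : 0 <= d i -> x 0 i = 0.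
  move=> di; have iN : i \in N by [].
  have /rowP/(_ (enum_rank_in iN i)) := xproj; rewrite !mxE => xi.
  rewrite -[RHS]xi (bigD1 i) //= !mxE enum_rankK_in // eqxx mulr1.
  rewrite big1 ?addr0 // => j /negPf ji.
  by rewrite mxE enum_rankK_in // ji mulr0.
have term_le0 i : d i * `|x 0 i| ^+ 2 <= 0.
  have [/x0 ->|] := real_leP (real0 C) (d_real i).
    by rewrite normr0 expr0n mulr0.
  by move=> /ltW di; rewrite mulr_le0_ge0 // exprn_ge0.
case/eqP: xN0; apply/rowP => i; rewrite mxE.
have sum0 : \sum_i - (d i * `|x 0 i| ^+ 2) = 0.
  by apply/le_anti; rewrite sumrN oppr_le0 V_ge0 // oppr_ge0 sumr_le0.
have term_ge0 j : true -> 0 <= - (d j * `|x 0 j| ^+ 2) by rewrite oppr_ge0.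
have /eqP := psumr_eq0P term_ge0 sum0 (erefl : xpredT i).
rewrite oppr_eq0 mulf_eq0 expf_eq0 normr_eq0 /= => /orP[/eqP di0|/eqP //].
by apply: x0; rewrite di0.
Qed.

Lemma spectral_form n (A : 'M[C]_n) (x : 'rV_n) :
    A \is hermsymmx ->
  (x *m A *m x ^t*) 0 0 =
    \sum_i spectral_diag A 0 i * `|(x *m (spectralmx A) ^t*) 0 i| ^+ 2.
Proof.
move=> /hermitian_normalmx /orthomx_spectralP A_eq.
rewrite {1}A_eq invmx_unitary ?spectral_unitarymx //.
set P := spectralmx A; set y := x *m P ^t*.
have -> : x *m (P ^t* *m diag_mx (spectral_diag A) *m P) *m x ^t*
         = y *m diag_mx (spectral_diag A) *m y ^t*.
  by rewrite trmx_mul map_mxM trmxCK !mulmxA.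
rewrite mxE; apply: eq_bigr => i _.
by rewrite mul_mx_diag !mxE mulrAC normCK mulrC.
Qed.

Lemma spectral_dot n (A : 'M[C]_n) (x : 'rV_n) :
  (x *m x ^t*) 0 0 = \sum_i `|(x *m (spectralmx A) ^t*) 0 i| ^+ 2.
Proof.
set P := spectralmx A.
have -> : x *m x ^t* = (x *m P ^t*) *m (x *m P ^t*) ^t*.
  rewrite trmx_mul map_mxM trmxCK mulmxA.
  rewrite -(invmx_unitary (spectral_unitarymx A)).
  by rewrite mulmxKV ?spectral_unit.
by rewrite mxE; apply: eq_bigr => i _; rewrite !mxE normCK.
Qed.

(** Courant-Fischer principle. In the coordinates of an orthonormal eigenbasis
    the form [x A x^* - c x x^*] is diagonal with entries [d i - c], so
    [rank_diag_form_ge0] applies. The factor [e] is [1] or [-1] in the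
    applications, and covers both directions of the inequality at once. *)
Lemma rank_le_spectral_count m n (A : 'M[C]_n) (V : 'M_(m, n)) (e c : C) :
    A \is hermsymmx -> e \is Num.real -> c \is Num.real ->
    (forall x : 'rV_n, (x <= V)%MS ->
       0 <= e * ((x *m A *m x ^t*) 0 0 - c * (x *m x ^t*) 0 0)) ->
  (\rank V <= #|[pred i | (0 <= e * (spectral_diag A 0 i - c))%R]|)%N.
Proof.
move=> A_herm e_real c_real V_ge0; set Q := (spectralmx A) ^t*.
have Qunit : Q \in unitmx.
  by rewrite unitarymx_unit // trmxC_unitary spectral_unitarymx.
have rankVQ : \rank (V *m Q) = \rank V.
  by rewrite mxrankMfree // row_free_unit.
rewrite -rankVQ; apply: rank_diag_form_ge0 => [i|y].
  rewrite rpredM // rpredB //.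
  exact/mxOverP/hermitian_spectral_diag_real.
case/submxP => u ->; rewrite mulmxA.
have := V_ge0 (u *m V) (submxMl _ _).
rewrite spectral_form // (spectral_dot A) mulr_sumr -sumrB mulr_sumr -/Q.
by under eq_bigr => i _ do rewrite -mulrBl mulrA.
Qed.
End Hermitian.

Section RealSymmetric.
Local Open Scope complex_scope.
Local Open Scope sesquilinear_scope.
Context {R : rcfType}.
Local Notation C := R[i].
Local Notation toC := (map_mx (real_complex R)).

Lemma real_sym_herm n (A : 'M[R]_n) : A^T = A -> toC A \is hermsymmx.
Proof.
move=> symA; apply/is_hermitianmxP; rewrite expr0 scale1r -[in RHS]symA.
apply/matrixP => i j; rewrite !mxE; apply/esym/CrealP/complex_realP.
by exists (A i j).
Qed.

(** The list [eigenvalues A] only records the roots lying in [R]. None is lost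
    for a symmetric matrix, because the spectral diagonal of its
    complexification is real. *)
Lemma eigenvalues_spectral n (A : 'M[R]_n) : A^T = A ->
  exists2 d : 'I_n -> R, spectral_diag (toC A) = \row_i (d i)%:C
    & perm_eq (eigenvalues A) (codom d).
Proof.
move=> symA; set D := spectral_diag _.
have A_herm := real_sym_herm symA.
pose d i := complex.Re (D 0 i).
have D_eq : D = \row_i (d i)%:C.
  apply/rowP => i; rewrite mxE RRe_real //.
  exact/mxOverP/hermitian_spectral_diag_real.
exists d => //; apply: perm_eigenvalues.
apply: (map_poly_inj (real_complex R)).
have /orthomx_spectralP A_eq := hermitian_normalmx A_herm.
rewrite map_char_poly /= A_eq char_poly_conj ?spectral_unit // -/D D_eq.
rewrite char_poly_trig ?diag_mx_is_trig // big_map big_enum rmorph_prod /=.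
by apply: eq_bigr => i _; rewrite !mxE eqxx mulr1n map_polyXsubC.
Qed.

Lemma rank_le_count_eigenvalues_ge m n (A : 'M[R]_n) (V : 'M[C]_(m, n))
    (c : R) :
    A^T = A ->
    (forall x : 'rV_n, (x <= V)%MS ->
       c%:C * (x *m x ^t*) 0 0 <= (x *m toC A *m x ^t*) 0 0) ->
  (\rank V <= count (>= c)%R (eigenvalues A))%N.
Proof.
move=> symA V_ge; have [d D_eq /permP ->] := eigenvalues_spectral symA.
apply: leq_trans (@rank_le_spectral_count _ _ _ (toC A) V 1 c%:C _ _ _ _) _.
- exact: real_sym_herm.
- exact: rpred1.
- by apply/complex_realP; exists c.
- by move=> x xV; rewrite mul1r subr_ge0 V_ge.
rewrite count_map cardE size_filter enumT; apply: sub_count => i /=.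
by rewrite inE mul1r D_eq mxE subr_ge0 lecR.
Qed.

Lemma rank_le_count_eigenvalues_le m n (A : 'M[R]_n) (V : 'M[C]_(m, n))
    (c : R) :
    A^T = A ->
    (forall x : 'rV_n, (x <= V)%MS ->
       (x *m toC A *m x ^t*) 0 0 <= c%:C * (x *m x ^t*) 0 0) ->
  (\rank V <= count (<= c)%R (eigenvalues A))%N.
Proof.
move=> symA V_le; have [d D_eq /permP ->] := eigenvalues_spectral symA.
apply: leq_trans (@rank_le_spectral_count _ _ _ (toC A) V (-1) c%:C _ _ _ _) _.
- exact: real_sym_herm.
- by rewrite rpredN rpred1.
- by apply/complex_realP; exists c.
- by move=> x xV; rewrite mulN1r oppr_ge0 subr_le0 V_le.
rewrite count_map cardE size_filter enumT; apply: sub_count => i /=.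
by rewrite inE mulN1r oppr_ge0 D_eq mxE subr_le0 lecR.
Qed.

Lemma le_largest_eigenvalue n (A : 'M[R]_n) (c : R) :
  (0 < count (>= c)%R (eigenvalues A))%N -> c <= largest_eigenvalue A.
Proof.
rewrite -has_count => /hasP[a aA ca]; apply: le_trans ca _.
exact: le_bigmax_seq.
Qed.

Lemma count_eigenvalues_le0 n (A : 'M[R]_n) :
  count (<= 0)%R (eigenvalues A) = (n_neg A + n_zero A)%N.
Proof.
rewrite /n_neg /n_zero; elim: (eigenvalues A) => //= a s ->.
by case: ltgtP; rewrite ?addnS ?addn0 ?add0n.
Qed.

Lemma count_eigenvalues_ge0 n (A : 'M[R]_n) :
  count (>= 0)%R (eigenvalues A) = (n_zero A + n_pos A)%N.
Proof.
rewrite /n_zero /n_pos; elim: (eigenvalues A) => //= a s ->.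
by case: ltgtP; rewrite ?addnS ?addn0 ?add0n.
Qed.

(** The rows of [rowsub f 1%:M] are the basis vectors selected by [f], so
    [u *m rowsub f 1%:M] is [u] extended by zero: its norm is that of [u], and
    a form restricts on it to a principal submatrix. *)
Lemma dot_rowsub1 n k (f : 'I_k -> 'I_n) (u : 'rV[C]_k) :
    injective f ->
  (u *m rowsub f 1%:M) *m (u *m rowsub f 1%:M) ^t* = u *m u ^t*.
Proof.
move=> f_inj; rewrite trmx_mul map_mxM mulmxA -[u *m _ *m _]mulmxA.
suff -> : rowsub f 1%:M *m (rowsub f 1%:M) ^t* = 1%:M :> 'M[C]_k.
  by rewrite mulmx1.
apply/matrixP => a b; rewrite mul_rowsub_mx mul1mx !mxE rmorph_nat.
by rewrite (inj_eq f_inj) eq_sym.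
Qed.

Lemma form_rowsub1 n k (f : 'I_k -> 'I_n) (A : 'M[C]_n) (u : 'rV[C]_k) :
  (u *m rowsub f 1%:M) *m A *m (u *m rowsub f 1%:M) ^t* =
    u *m mxsub f f A *m u ^t*.
Proof.
have <- : rowsub f 1%:M *m A *m (rowsub f 1%:M) ^t* = mxsub f f A.
  apply/matrixP => a b; rewrite mul_rowsub_mx mul1mx !mxE (bigD1 (f b)) //=.
  rewrite big1 => [|j /negPf jb].
    by rewrite !mxE eqxx rmorph1 mulr1 addr0.
  by rewrite !mxE eq_sym jb rmorph0 mulr0.
by rewrite trmx_mul map_mxM !mulmxA.
Qed.

Lemma row_free_rowsub1 n k (f : 'I_k -> 'I_n) :
  injective f -> row_free (rowsub f 1%:M : 'M[C]_(k, n)).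
Proof.
move=> f_inj; apply/row_freeP; exists (colsub f 1%:M).
by apply/matrixP => a b; rewrite mul_rowsub_mx mul1mx !mxE (inj_eq f_inj).
Qed.

Lemma form_const1 k (u : 'rV[C]_k) :
  (u *m const_mx 1 *m u ^t*) 0 0 = `|\sum_a u 0 a| ^+ 2.
Proof.
rewrite mxE normCK rmorph_sum mulr_sumr; apply: eq_bigr => a _.
by rewrite !mxE; congr (_ * _); apply: eq_bigr => b _; rewrite mxE mulr1.
Qed.

Lemma diag_le_largest_eigenvalue n (A : 'M[R]_n) i :
  A^T = A -> A i i <= largest_eigenvalue A.
Proof.
move=> symA; apply: le_largest_eigenvalue.
have f_inj : injective (fun _ : 'I_1 => i) by move=> a b _; rewrite !ord1.
have <- := eqP (row_free_rowsub1 f_inj).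
apply: rank_le_count_eigenvalues_ge => // _ /submxP[u ->].
rewrite dot_rowsub1 // form_rowsub1 !mxE !big_ord1 !mxE big_ord1 !mxE.
by rewrite mulrCA mulrA.
Qed.

(** * Matrices with a principal submatrix of ones *)

Section OnesSubmatrix.
Variables (n k : nat) (A : 'M[R]_n) (f : 'I_k -> 'I_n).
Hypotheses (symA : A^T = A) (f_inj : injective f).
Hypothesis A_ones : forall a b, A (f a) (f b) = 1.

Let mxsub_ones : mxsub f f (toC A) = const_mx 1.
Proof. by apply/matrixP => a b; rewrite !mxE A_ones. Qed.

Lemma ones_le_n_zero_pos : (k <= n_zero A + n_pos A)%N.
Proof.
rewrite -count_eigenvalues_ge0 -[X in (X <= _)%N](eqP (row_free_rowsub1 f_inj)).
apply: rank_le_count_eigenvalues_ge => // _ /submxP[u ->].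
by rewrite mul0r form_rowsub1 mxsub_ones form_const1 exprn_ge0.
Qed.

(** Among the vectors supported on the image of [f], those of coordinate sum
    zero form a space of dimension at least [k - 1] on which the form of [A]
    vanishes. *)
Lemma ones_le_n_neg_zero : (k <= n_neg A + n_zero A + 1)%N.
Proof.
pose one := const_mx 1 : 'cV[C]_k.
rewrite -count_eigenvalues_le0 addn1 -ltnS.
apply: (@leq_trans (\rank (kermx one *m rowsub f (1%:M : 'M[C]_n))).+2).
  rewrite mxrankMfree ?row_free_rowsub1 // mxrank_ker.
  by have := rank_leq_col one; lia.
rewrite !ltnS; apply: rank_le_count_eigenvalues_le => // _ /submxP[w ->].
rewrite mulmxA form_rowsub1 mxsub_ones form_const1 mul0r.
set u := w *m _; suff -> : \sum_a u 0 a = 0 by rewrite normr0 expr0n.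
have : u *m one = 0 by rewrite -mulmxA mulmx_ker mulmx0.
move=> /matrixP/(_ 0 0); rewrite !mxE => uone; rewrite -[RHS]uone.
by apply: eq_bigr => a _; rewrite [one _ _]mxE mulr1.
Qed.

(** The indicator vector of the image of [f] has square norm [k] and form value
    [k ^ 2]. *)
Lemma ones_le_largest_eigenvalue : (0 < k)%N -> k%:R <= largest_eigenvalue A.
Proof.
move=> k_gt0; apply: le_largest_eigenvalue.
pose one := const_mx 1 : 'rV[C]_k.
have <- : \rank (one *m rowsub f (1%:M : 'M[C]_n)) = 1%N.
  rewrite mxrankMfree ?row_free_rowsub1 // rank_rV.
  suff -> : one != 0 by [].
  apply/eqP => /rowP/(_ (Ordinal k_gt0)); rewrite !mxE => /eqP.
  by rewrite oner_eq0.
apply: rank_le_count_eigenvalues_ge => // _ /submxP[w ->].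
rewrite mulmxA dot_rowsub1 // form_rowsub1 mxsub_ones form_const1.
have wE a : (w *m one) 0 a = w 0 0 by rewrite mxE big_ord1 [one _ _]mxE mulr1.
rewrite mxE.
under eq_bigr => a _ do rewrite [X in _ * X]mxE [X in _ * _ X]mxE wE -normCK.
under [in leRHS]eq_bigr => a _ do rewrite wE.
rewrite !sumr_const !card_ord normrMn exprMn_n rmorph_nat mulr_natl -mulrnA.
by rewrite mulnn.
Qed.
End OnesSubmatrix.
End RealSymmetric.

(** * The unified matrix of a hypergraph *)

Section Unified.
Variables (R : rcfType) (T : finType) (H : hypergraph T).
Implicit Types (S : {set T}) (v w : T).

Lemma two_partitionC e S S' : two_partition e S S' = two_partition e S' S.
Proof. by rewrite /two_partition disjoint_sym setUC andbCA. Qed.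

Lemma unified_matrix_sym : (unified_matrix R H)^T = unified_matrix R H.
Proof.
apply/matrixP => i j; rewrite !mxE /unified_entry.
move: (enum_val i) (enum_val j) => S S'; rewrite (eq_sym S').
have -> : [exists e, (e \in edges H) && two_partition e S' S] =
          [exists e, (e \in edges H) && two_partition e S S'].
  by apply: eq_existsb => e; rewrite two_partitionC.
by have [->|//] := eqVneq S S'.
Qed.

Lemma unified_entry_ge0 S S' : 0 <= unified_entry R H S S'.
Proof. by rewrite /unified_entry; case: ifP => _ //; case: ifP. Qed.

Lemma singleton_in_parts_index v :
  v \in vertices H -> [set v] \in parts_index H.
Proof. by move=> vH; rewrite inE orbC imset_f. Qed.

Lemma clique_edge K e : complete_clique K H ->
  e != set0 -> e \subset vertices K -> e \in edges H.
Proof.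
case=> -[_ /msubset_subset sub_edges] K_complete e0 eK; apply: sub_edges.
by rewrite in_mset K_complete e0 eK.
Qed.

Lemma clique_entry K v w : complete_clique K H ->
    v \in vertices K -> w \in vertices K ->
  unified_entry R H [set v] [set w] = 1.
Proof.
move=> clK vK wK; rewrite /unified_entry.
have set1N0 u : [set u] != set0 :> {set T}.
  by apply/set0Pn; exists u; rewrite inE.
have [->|vw] := eqVneq v w.
  by rewrite eqxx cards1 (clique_edge clK) // sub1set.
case: ifP => // _; rewrite ifT //; apply/existsP; exists [set v; w].
rewrite (clique_edge clK) ?subUset ?sub1set ?vK //=; last first.
  by apply/set0Pn; exists v; rewrite !inE eqxx.
by rewrite /two_partition !set1N0 disjoints1 inE vw eqxx.
Qed.

(** The loops of the clique give the diagonal ones, its edges of size two the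
    others. *)
Lemma clique_ones_submatrix K : complete_clique K H ->
  exists2 f : 'I_#|vertices K| -> 'I_#|parts_index H|,
    injective f & forall a b, unified_matrix R H (f a) (f b) = 1.
Proof.
move=> clK; have [[/subsetP sub_vertices _] _] := clK.
have [v0 v0H] := set0Pn _ (vertices_neq0 H).
pose f (a : 'I_#|vertices K|) :=
  enum_rank_in (singleton_in_parts_index v0H) [set enum_val a].
have fK a : enum_val (f a) = [set enum_val a].
  by rewrite enum_rankK_in ?singleton_in_parts_index ?sub_vertices ?enum_valP.
exists f => [a b fab|a b].
  by apply/enum_val_inj/set1_inj; rewrite -!fK fab.
by rewrite mxE !fK (clique_entry clK) ?enum_valP.
Qed.

Lemma largest_unified_eigenvalue_ge0 :
  0 <= largest_eigenvalue (unified_matrix R H).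
Proof.
have [v vH] := set0Pn _ (vertices_neq0 H).
pose i := enum_rank_in (singleton_in_parts_index vH) [set v].
apply: le_trans (diag_le_largest_eigenvalue i unified_matrix_sym).
by rewrite mxE unified_entry_ge0.
Qed.
End Unified.

Theorem theorem9p10 (R : rcfType) (T : finType) (H : hypergraph T)
    (simpleH : no_multiple_edges H) :
  let U := unified_matrix R H in
  (complete_clique_number H)%:R <=
    Num.min (Num.min (n_neg U + n_zero U + 1)%N%:R (n_zero U + n_pos U)%N%:R)
            (largest_eigenvalue U).
Proof.
cbv zeta; set U := unified_matrix R H; rewrite !le_min !ler_nat -andbA.
have symU : U^T = U := unified_matrix_sym R H.
(* Proving the bound for [0] and for every clique size suffices, as the clique
   number is a maximum with default [0]. *)
pose bounded k := [&& (k <= n_neg U + n_zero U + 1)%N,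
                      (k <= n_zero U + n_pos U)%N
                    & k%:R <= largest_eigenvalue U].
apply: (big_ind bounded) => [|k l kP lP|W /asboolP[K [clK <-]]].
- by rewrite /bounded !leq0n largest_unified_eigenvalue_ge0.
- by case: (leqP k l).
have [f f_inj f_ones] := clique_ones_submatrix R clK.
have K_gt0 : (0 < #|vertices K|)%N by rewrite card_gt0 vertices_neq0.
rewrite /bounded (ones_le_n_neg_zero symU f_inj f_ones).
by rewrite (ones_le_n_zero_pos symU f_inj f_ones)
           (ones_le_largest_eigenvalue symU f_inj f_ones).
Qed.
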